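(* Let $k$ be a positive integer. If two virtual knots $K$ and $K'$ are related by a finite sequence of $2k$-moves, then the following hold: (i) $J_{n}(K)\equiv J_{n}(K')\pmod{k}$ for any nonzero integer $n$. (ii) $J(K)\equiv J(K')\pmod{2k}$. Here $J_n$ denotes the $n$-writhe and $J$ the odd writhe.
   Context: **Gauss diagrams and virtual knots.** A Gauss diagram is an oriented circle with finitely many chords, each having a sign $\pm1$ and an orientation (from its initial to its terminal endpoint), whose endpoints are distinct points of the circle; it is considered up to orientation-preserving homeomorphism of the circle, i.e. only the cyclic order of endpoints matters. Endpoints are called consecutive (adjacent) if no other endpoints lie between them on the circle. A virtual knot is an equivalence class of Gauss diagrams under the Reidemeister moves (a Gauss diagram in the class is called a Gauss diagram of the knot): - Move I: add or remove a chord (any sign and orientation) whose two endpoints are adjacent. - Move II: add or remove two chords of opposite signs whose initial endpoints are adjacent and whose terminal endpoints are adjacent. - Move III: suppose there are three pairwise disjoint arcs $T,M,B$ of the circle and three chords $c_{TM}$, $c_{TB}$, $c_{MB}$, oriented from $T$ to $M$, from $T$ to $B$, from $M$ to $B$ respectively, with signs $e_{TM},e_{TB},e_{MB}$, such that each arc contains exactly two endpoints, both belonging to these chords. Put $\delta_T=+1$ if $c_{TM}$ comes before $c_{TB}$ along $T$ (else $-1$), $\delta_M=+1$ if $c_{TM}$ comes before $c_{MB}$ along $M$ (else $-1$), $\delta_B=+1$ if $c_{TB}$ comes before $c_{MB}$ along $B$ (else $-1$). If for some $c\in\{\pm1\}$ one has $\delta_T=c\,e_{TB}$, $\delta_M=c\,e_{MB}$,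 $\delta_B=c\,e_{TM}e_{TB}e_{MB}$, then the move exchanges the two endpoints on each of the three arcs. (Equivalently, virtual knots are virtual knot diagrams modulo generalized Reidemeister moves; chords correspond to real crossings, oriented from over to under.) **$2k$-move.** A $2k$-move on a Gauss diagram adds or removes $2k$ chords $\gamma_1,\dots,\gamma_{2k}$, all of the same sign $\varepsilon$, for which there are two disjoint arcs $A,A'$ of the circle such that each $\gamma_i$ joins $A$ to $A'$, the arcs contain no other endpoints, the endpoints on $A$ occur in the order $\gamma_1,\dots,\gamma_{2k}$, the endpoints on $A'$ occur in the order $\gamma_1,\dots,\gamma_{2k}$ or in the reverse order, and initial and terminal endpoints alternate along $A$ (hence also along $A'$). (This corresponds to adding or removing $2k$ half-twists on two strands of a diagram.) Two virtual knots are related by a $2k$-move if some Gauss diagram of one is obtained from some Gauss diagram of the other by a $2k$-move. **Writhes.** Let $\gamma$ be a chord with sign $\varepsilon$ in a Gauss diagram $G$. Assign $\varepsilon$ to its terminal endpoint and $-\varepsilon$ to its initial endpoint. Let $\alpha$ be the open arc of the circle running, along the orientation of the circle, from the initial endpoint of $\gamma$ to its terminal endpoint. The index $\mathrm{ind}(\gamma)$ is the sum of the signs of all endpoints of chords on $\alpha$. For an integer $n$, $J_n(G)$ is the sum of signs of the chords of $G$ with index $n$. For $n\neq 0$, $J_n(G)$ is an invariant of the virtual knot $K$ represented by $G$ (known result), called the $n$-writhe $J_n(K)$. The odd writhe is $J(K)=\sum_{n\in\mathbb{Z}}J_{2n-1}(K)$. *)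

(* Defs.v *)
From HB Require Import structures.
From Stdlib Require Import Relation_Operators Operators_Properties.
From mathcomp Require Import all_boot all_order all_algebra.
From mathcomp Require Import generic_quotient.
From mathcomp Require Import boolp classical_sets fsbigop.

Set Implicit Arguments.
Unset Strict Implicit.
Unset Printing Implicit Defensive.

Import GRing.Theory.
Local Open Scope ring_scope.
Local Open Scope quotient_scope.

(* An endpoint of a chord: the label of the chord, whether this is the initial
   ([true]) or the terminal ([false]) endpoint, and the sign of the chord
   ([true] for +1). *)
Definition endpoint : Type := (nat * bool * bool)%type.
Definition label (x : endpoint) : nat := x.1.1.
Definition initial (x : endpoint) : bool := x.1.2.
Definition positive (x : endpoint) : bool := x.2.

Definition sg (b : bool) : int := if b then 1 else -1.

(* The other endpoint of the same chord. *)
Definition mate (x : endpoint) : endpoint := (label x, ~~ initial x, positive x).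

(* A Gauss diagram is written as the word of its endpoints, read along the
   circle from an arbitrary base point. *)
Definition is_gauss (w : seq endpoint) : bool :=
  uniq [seq (label x, initial x) | x <- w] && all (fun x => mate x \in w) w.

Record gauss_diagram := GaussDiagram {
  gword :> seq endpoint;
  gwordP : is_gauss gword }.

HB.instance Definition _ := [isSub for gword].
HB.instance Definition _ := [Choice of gauss_diagram by <:].

(* Two words present the same diagram when they differ by the choice of the
   base point and by a renaming of the chords. *)
Definition same_diagram (w w' : seq endpoint) : Prop :=
  exists (f : nat -> nat) (i : nat),
    {in [seq label x | x <- w] &, injective f} /\
    w' = rot i [seq (f (label x), initial x, positive x) | x <- w].

(* [x] before [y] if [d], [y] before [x] otherwise. *)
Definition pair_in_order (d : bool) (x y : endpoint) : seq endpoint :=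
  if d then [:: x; y] else [:: y; x].

(* The base point may be moved by [same_diagram], so one of the arcs involved
   is always placed at the start of the word; for move III the arcs T, M, B may
   occur in either of the two cyclic orders. Distinctness of the chords involved
   is forced by both words being Gauss diagrams (see [vk_step]). *)
Inductive reidemeister : seq endpoint -> seq endpoint -> Prop :=
| MoveI (x : endpoint) (u : seq endpoint) :
    reidemeister u ([:: x; mate x] ++ u)
| MoveII (a b : nat) (e d : bool) (u v : seq endpoint) :
    reidemeister (u ++ v)
      ([:: (a, true, e); (b, true, ~~ e)] ++ u ++
       pair_in_order d (a, false, e) (b, false, ~~ e) ++ v)
| MoveIII (tm tb mb : nat) (eTM eTB eMB dT dM dB c cyc : bool)
    (u v w : seq endpoint) :
    let T d := pair_in_order d (tm, true, eTM) (tb, true, eTB) in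
    let M d := pair_in_order d (tm, false, eTM) (mb, true, eMB) in
    let B d := pair_in_order d (tb, false, eTB) (mb, false, eMB) in
    let W dT dM dB := if cyc then T dT ++ u ++ M dM ++ v ++ B dB ++ w
                             else T dT ++ u ++ B dB ++ v ++ M dM ++ w in
    sg dT = sg c * sg eTB ->
    sg dM = sg c * sg eMB ->
    sg dB = sg c * (sg eTM * sg eTB * sg eMB) ->
    reidemeister (W dT dM dB) (W (~~ dT) (~~ dM) (~~ dB)).

Definition vk_step (G H : gauss_diagram) : Prop :=
  same_diagram G H \/ reidemeister G H.

Definition vk_equiv : gauss_diagram -> gauss_diagram -> Prop :=
  clos_refl_sym_trans gauss_diagram vk_step.

Definition vk_equivb (G H : gauss_diagram) : bool := `[< vk_equiv G H >].

Lemma vk_equivb_equiv : equiv_class_of vk_equivb.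
Proof.
split=> [G|G H|H G L].
- by apply/asboolP; exact: rst_refl.
- by apply/asboolP/asboolP => ?; exact: rst_sym.
- by move=> /asboolP GH /asboolP HL; apply/asboolP; exact: rst_trans GH HL.
Qed.

Canonical vk_equiv_rel := EquivRelPack vk_equivb_equiv.

Definition virtual_knot := {eq_quot vk_equiv_rel}.
HB.instance Definition _ := Choice.on virtual_knot.
HB.instance Definition _ := EqQuotient.on virtual_knot.

Definition diagram_of (G : gauss_diagram) (K : virtual_knot) : Prop :=
  \pi_virtual_knot G = K.

(* The chords are [g 0], ..., [g (2k - 1)], all of sign [e]; [s] tells whether
   the first endpoint on the arc A is initial, and [r] whether A' is traversed
   in the reverse order. *)
Inductive adds_twists (k : nat) : seq endpoint -> seq endpoint -> Prop :=
| AddsTwists (g : nat -> nat) (e s r : bool) (u v : seq endpoint) :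
    let A := mkseq (fun i => (g i, s (+) odd i, e)) (2 * k) in
    let A' := if r then rev (map mate A) else map mate A in
    adds_twists k (u ++ v) (A ++ u ++ A' ++ v).

Definition related_by_2k_move (k : nat) (K K' : virtual_knot) : Prop :=
  exists G G' : gauss_diagram,
    [/\ diagram_of G K, diagram_of G' K' &
        adds_twists k G G' \/ adds_twists k G' G].

Definition related_by_2k_moves (k : nat) : virtual_knot -> virtual_knot -> Prop :=
  clos_refl_trans virtual_knot (related_by_2k_move k).

Definition endpoint_sign (x : endpoint) : int :=
  if initial x then - sg (positive x) else sg (positive x).

(* The index of the chord with initial endpoint [x]. [arc w x y] lists the
   letters met along the cyclic word [w] from [x] included to [y] excluded. *)
Definition index_of (w : seq endpoint) (x : endpoint) : int :=
  \sum_(y <- behead (arc w x (mate x))) endpoint_sign y.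

Definition gwrithe (G : gauss_diagram) (n : int) : int :=
  \sum_(x <- gword G | initial x && (index_of G x == n)) sg (positive x).

(* For [n != 0], every diagram of [K] has the same [gwrithe] at [n] as the
   canonical representative. *)
Definition nwrithe (K : virtual_knot) (n : int) : int := gwrithe (repr K) n.

(* A finitely supported sum. *)
Definition odd_writhe (K : virtual_knot) : int :=
  \sum_(n \in [set: int]%classic) nwrithe K (2 * n - 1).

(* Main.v *)
(* Let the height of an endpoint be the sum of the signs of the endpoints read
   before it from the base point. Since the signs of all endpoints sum to zero,
   the index of a chord is the difference of the heights of its two ends, up to
   the sign of the chord, wherever the base point lies. Inserting blocks of
   endpoints with zero total sign changes no other height, and in a move III the
   three exchanges cancel in every index. Reading the indices of the added chords
   the same way, in a 2k-move k of them have index m and k have index -m for a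
   single m, all with the same sign e. For each set P of indices not containing
   0, the sum of the signs of the chords with index in P is therefore a knot
   invariant, and a 2k-move changes it by e k ([m in P] + [-m in P]): take P to
   be {n} with n nonzero, or the odd integers, a set stable under negation. *)

Require Import Defs.
From mathcomp Require Import all_boot all_order all_algebra.
From mathcomp Require Import generic_quotient boolp classical_sets fsbigop.
From mathcomp Require Import ring zify.

Set Implicit Arguments.
Unset Strict Implicit.
Unset Printing Implicit Defensive.

Import Order.TTheory GRing.Theory Num.Theory.
Local Open Scope ring_scope.

(** * Heights, and the index of a chord as a difference of heights *)

Fixpoint height (w : seq endpoint) (x : endpoint) : int :=
  if w is y :: w' then
    if y == x then 0 else endpoint_sign y + height w' x
  else 0.

Definition total (w : seq endpoint) : int := \sum_(y <- w) endpoint_sign y.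

(** If [x] is read before [mate x], removing the sign of [x] leaves the sum strictly between the
    two. If [mate x] is read first, this is minus the sum strictly between [mate x] and [x], which
    is again the sum from [x] round to [mate x], as all signs add up to zero. *)
Definition hindex (w : seq endpoint) (x : endpoint) : int :=
  height w (mate x) - height w x - endpoint_sign x.

Definition writhe (P : pred int) (w : seq endpoint) : int :=
  \sum_(x <- w | initial x && P (hindex w x)) sg (positive x).

Lemma mateK : involutive mate.
Proof. by case=> [[l i] e]; rewrite /mate /= negbK. Qed.

Lemma mate_neq x : (mate x == x) = false.
Proof. by case: x => [[l i] e]; apply/eqP => -[] /=; case: i. Qed.

Lemma endpoint_sign_mate x : endpoint_sign (mate x) = - endpoint_sign x.
Proof.
case: x => [[l i] e]; rewrite /endpoint_sign /=.
by case: i => //=; rewrite opprK.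
Qed.

Lemma hindex_mate w x : hindex w (mate x) = - hindex w x.
Proof. by rewrite /hindex mateK endpoint_sign_mate; ring. Qed.

Lemma gauss_uniq w : is_gauss w -> uniq w.
Proof. by case/andP => /map_uniq. Qed.

Lemma gauss_mate w x : is_gauss w -> (mate x \in w) = (x \in w).
Proof.
case/andP=> _ /allP wP; apply/idP/idP => [/wP|/wP //].
by rewrite mateK.
Qed.

Lemma total_cat p q : total (p ++ q) = total p + total q.
Proof. by rewrite /total big_cat. Qed.

Lemma total_cons x p : total (x :: p) = endpoint_sign x + total p.
Proof. by rewrite /total big_cons. Qed.

Lemma total_nil : total [::] = 0.
Proof. by rewrite /total big_nil. Qed.

(** The involution [mate] permutes the endpoints and reverses their signs, so the total is its own
    opposite. *)
Lemma total_gauss w : is_gauss w -> total w = 0.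
Proof.
move=> wG.
have wP : perm_eq w (map mate w).
  apply: uniq_perm; first exact: gauss_uniq.
    by rewrite (map_inj_uniq (can_inj mateK)) gauss_uniq.
  by move=> x; rewrite -[x in RHS]mateK (mem_map (can_inj mateK)) gauss_mate.
have : total w = - total w.
  rewrite {1}/total (perm_big _ wP) big_map /total -sumrN.
  by apply: eq_bigr => x _; rewrite endpoint_sign_mate.
lia.
Qed.

Lemma height_cat p q x :
  height (p ++ q) x = if x \in p then height p x else total p + height q x.
Proof.
elim: p => [|y p IHp] /=; first by rewrite total_nil add0r.
rewrite in_cons eq_sym; case: eqP => //= _.
by rewrite IHp total_cons; case: ifP => // _; rewrite addrA.
Qed.

(** Moving the base point shifts all heights by one constant: endpoints of [p] gain [total q], and
    those of [q] lose [total p], the opposite of [total q]. Differences of heights are thus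
    unchanged. *)
Lemma height_catC p q x : uniq (p ++ q) -> total (p ++ q) = 0 -> x \in p ++ q ->
  height (q ++ p) x = height (p ++ q) x + total q.
Proof.
rewrite cat_uniq total_cat mem_cat !height_cat.
move=> /and3P[_ /hasPn disj _] tot0 /orP[x1|x2].
  rewrite x1; case: ifP => [/disj|_]; first by rewrite /= x1.
  by rewrite addrC.
rewrite x2; have /= /negPf -> := disj _ x2.
by rewrite addrAC tot0 add0r.
Qed.

Lemma hindex_rot w i x : is_gauss w -> x \in w -> hindex (rot i w) x = hindex w x.
Proof.
rewrite -{1 2 4}(cat_take_drop i w) /rot => wG xw.
have wU := gauss_uniq wG; have w0 := total_gauss wG.
have mw : mate x \in take i w ++ drop i w by rewrite (gauss_mate x wG).
rewrite /hindex (height_catC wU w0 xw) (height_catC wU w0 mw) cat_take_drop.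
by ring.
Qed.

Lemma is_gauss_rot i w : is_gauss (rot i w) = is_gauss w.
Proof.
rewrite /is_gauss map_rot rot_uniq; congr andb.
by rewrite (eq_all_r (mem_rot i w)); apply: eq_all => x; rewrite mem_rot.
Qed.

Lemma index_ofE w x : is_gauss w -> x \in w -> index_of w x = hindex w x.
Proof.
move=> wG xw; have mw : mate x \in w by rewrite gauss_mate.
have xm : x != mate x by rewrite eq_sym mate_neq.
rewrite /index_of.
(* With the base point at [x], the height of [x] is 0 and [p1] is the open arc that defines the
   index. *)
have [i p1 p2 <- _ wE] := rot_to_arc (gauss_uniq wG) xw mw xm.
have : uniq (x :: p1 ++ mate x :: p2) by rewrite -wE rot_uniq gauss_uniq.
rewrite -(hindex_rot i wG xw) wE /hindex /= (negPf xm) !eqxx height_cat /= eqxx.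
rewrite cat_uniq => /and4P[_ _ /= /norP[/negPf -> _] _].
by rewrite /total; ring.
Qed.

Lemma gwritheE (G : gauss_diagram) n : gwrithe G n = writhe (pred1 n) G.
Proof.
rewrite /gwrithe /writhe big_seq_cond [RHS]big_seq_cond; apply: eq_bigl => x.
by case xG: (x \in gword G); rewrite // index_ofE // gwordP.
Qed.

(** * Change of base point and renaming of chords *)

Lemma height_map_in (h : endpoint -> endpoint) w x :
  {in w &, injective h} -> (forall y, endpoint_sign (h y) = endpoint_sign y) ->
  x \in w -> height (map h w) (h x) = height w x.
Proof.
move=> hI hs; elim: w hI => //= y w IHw hI.
have yw : y \in y :: w by rewrite mem_head.
have hI' : {in w &, injective h}.
  by move=> a b aw bw; apply: hI; rewrite in_cons ?aw ?bw orbT.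
rewrite in_cons => /predU1P[->|xw]; first by rewrite !eqxx.
have -> : (h y == h x) = (y == x).
  apply/eqP/eqP => [|-> //]; apply: hI => //.
  by rewrite in_cons xw orbT.
by rewrite hs IHw.
Qed.

Lemma writhe_same_diagram P (G H : gauss_diagram) :
  same_diagram G H -> writhe P G = writhe P H.
Proof.
case=> f [i [fI HE]].
pose h (x : endpoint) : endpoint := (f (label x), initial x, positive x).
have hI : {in gword G &, injective h}.
  move=> x y xG yG [fxy ixy exy].
  have := fI _ _ (map_f label xG) (map_f label yG) fxy.
  move: ixy exy; case: x {xG fxy} => [[? ?] ?]; case: y {yG} => [[? ?] ?] /=.
  by rewrite /label /initial /positive /= => -> -> ->.
have mapG : is_gauss (map h G) by rewrite -(is_gauss_rot i) -HE gwordP.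
have hGP : perm_eq (rot i (map h G)) (map h G) by rewrite perm_rot.
rewrite HE /writhe [RHS](perm_big _ hGP) big_map /=.
rewrite big_seq_cond [RHS]big_seq_cond; apply: eq_bigl => x.
case xG: (x \in gword G) => //=.
rewrite hindex_rot ?map_f // /hindex (height_map_in hI) //.
by rewrite -[mate (h x)]/(h (mate x)) (height_map_in hI) ?gauss_mate ?gwordP.
Qed.

(** * Insertion of blocks of total sign zero: moves I and II *)

Lemma hindex_insert z p q x :
  uniq (p ++ z ++ q) -> total z = 0 -> x \in p ++ q -> mate x \in p ++ q ->
  hindex (p ++ z ++ q) x = hindex (p ++ q) x.
Proof.
rewrite uniq_catCA cat_uniq => /and3P[_ /hasPn disj _] z0.
have heightE y : y \in p ++ q -> height (p ++ z ++ q) y = height (p ++ q) y.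
  move=> /disj /= /negPf yz; rewrite !height_cat yz z0.
  by case: ifP => // _; rewrite add0r.
by move=> xpq mpq; rewrite /hindex !heightE.
Qed.

(** Old chords keep their indices, so only the inserted endpoints contribute to the change. This
    serves moves I and II as well as the 2k-move. *)
Lemma writhe_insert P A B u v :
  is_gauss (u ++ v) -> is_gauss (A ++ u ++ B ++ v) -> total A = 0 -> total B = 0 ->
  let w := A ++ u ++ B ++ v in
  writhe P w = writhe P (u ++ v) +
    \sum_(x <- A ++ B | initial x && P (hindex w x)) sg (positive x).
Proof.
move=> oldG newG A0 B0 w.
have wP : perm_eq w ((u ++ v) ++ (A ++ B)).
  rewrite /w perm_sym perm_catC -catA perm_cat2l.
  by rewrite perm_catCA.
rewrite /writhe (perm_big _ wP) big_cat /=; congr (_ + _).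
rewrite big_seq_cond [RHS]big_seq_cond; apply: eq_bigl => x.
case xuv: (x \in u ++ v) => //=; have mx := gauss_mate x oldG; rewrite xuv in mx.
have wU := gauss_uniq newG.
have uBvU : uniq (u ++ B ++ v) by move: wU; rewrite cat_uniq => /and3P[].
have sub y : y \in u ++ v -> y \in [::] ++ (u ++ B ++ v).
  by rewrite /= !mem_cat => /orP[] ->; rewrite ?orbT.
rewrite (@hindex_insert A [::] (u ++ B ++ v) x wU A0 (sub _ xuv) (sub _ mx)).
by rewrite (@hindex_insert B u v x uBvU B0 xuv mx).
Qed.

(** The new chord has adjacent ends, hence index 0, and [P] excludes 0. *)
Lemma writhe_moveI P x u :
  ~~ P 0 -> is_gauss u -> is_gauss ([:: x; mate x] ++ u) ->
  writhe P ([:: x; mate x] ++ u) = writhe P u.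
Proof.
move=> P0 oldG newG.
have tot0 : total [:: x; mate x] = 0.
  by rewrite !total_cons total_nil endpoint_sign_mate; ring.
have hx : hindex ([:: x; mate x] ++ u) x = 0.
  by rewrite /hindex /= !eqxx eq_sym mate_neq; ring.
have := @writhe_insert P [:: x; mate x] [::] [::] u oldG newG tot0 total_nil.
rewrite !cat0s cats0 => ->.
by rewrite !big_cons big_nil hindex_mate hx oppr0 (negPf P0) !andbF addr0.
Qed.

Lemma writhe_moveII P a b e d u v :
  let w : seq endpoint := [:: (a, true, e); (b, true, ~~ e)] ++ u ++
           pair_in_order d (a, false, e) (b, false, ~~ e) ++ v in
  is_gauss (u ++ v) -> is_gauss w -> writhe P w = writhe P (u ++ v).
Proof.
move=> w oldG newG.
set A : seq endpoint := [:: (a, true, e); (b, true, ~~ e)] in w newG *.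
set B := pair_in_order d _ _ in w newG *.
have A0 : total A = 0 by rewrite !total_cons total_nil /endpoint_sign /=; case: (e).
have B0 : total B = 0.
  by rewrite /B; case: (d); rewrite !total_cons total_nil /endpoint_sign /=; case: (e).
rewrite /w writhe_insert // -/w.
have /gauss_uniq := newG; rewrite !cat_uniq => /and4P[_ _ _].
move=> /and3P[/hasPn disj _ _].
have notu y : y \in B -> (y \in u) = false.
  by move=> yB; apply: negbTE; apply: disj; rewrite mem_cat yB.
have aB : (a, false, e) \in B by rewrite /B; case: (d); rewrite !inE eqxx ?orbT.
have bB : (b, false, ~~ e) \in B by rewrite /B; case: (d); rewrite !inE eqxx ?orbT.
(* Both indices equal [total u + sg e] if [d] holds and [total u] otherwise; as the signs of the two
   chords are opposite, their contributions cancel. *)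
have hab : hindex w (a, true, e) = hindex w (b, true, ~~ e).
  rewrite /hindex /w /A /mate /= !(height_cat u) (notu _ aB) (notu _ bB) /B /=.
  case: (d); case: (e); rewrite /= ?xpair_eqE ?eqxx ?andbF /=.
  1-4: by rewrite /endpoint_sign /=; ring.
have sB : \sum_(x <- B | initial x && P (hindex w x)) sg (positive x) = 0.
  by rewrite big_hasC // /B; case: (d).
rewrite /= !big_cons sB hab /=; case: ifP => Pa; case: ifP => Pb.
- by case: (e); rewrite /= ?addr0 ?subrr ?addNr ?addr0.
- by rewrite Pa in Pb.
- by rewrite Pa in Pb.
- by rewrite addr0.
Qed.

(** * Exchange of adjacent endpoints: move III *)

Definition swap_shift (d : bool) (a b x : endpoint) : int :=
  sg d * ((x == a)%:R * endpoint_sign b - (x == b)%:R * endpoint_sign a).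

(** The endpoint that came first now also has the other one before it and gains its sign; the other
    loses the sign of the first. *)
Lemma height_swap d p q a b x : uniq (p ++ pair_in_order d a b ++ q) ->
  height (p ++ pair_in_order (~~ d) a b ++ q) x =
  height (p ++ pair_in_order d a b ++ q) x +
  swap_shift d a b x.
Proof.
rewrite /swap_shift => wU.
have [ap bp ab] : [/\ a \notin p, b \notin p & a != b].
  move: wU; rewrite uniq_catCA; case: d => /=; rewrite !inE !mem_cat !negb_or.
    by case/andP=> /and3P[-> -> _] /andP[/andP[-> _] _].
  by rewrite eq_sym; case/andP=> /and3P[-> -> _] /andP[/andP[-> _] _].
have tot : total (pair_in_order d a b) = total (pair_in_order (~~ d) a b).
  by case: d {wU}; rewrite !total_cons total_nil; ring.
rewrite !height_cat tot.
case: ifP => [xp|_].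
  have -> : (x == a) = false by apply/negbTE; apply: contraNneq ap => <-.
  have -> : (x == b) = false by apply/negbTE; apply: contraNneq bp => <-.
  by rewrite !mul0r subr0 mulr0 addr0.
rewrite /pair_in_order; case: d {wU tot} => /=; rewrite !inE ![_ == x]eq_sym.
all: case: (x =P a) => [->|_]; rewrite ?(negPf ab) /= ?eqxx.
all: try case: (x == b).
all: by rewrite /=; ring.
Qed.

Lemma perm_pair_in_order d a b :
  perm_eq (pair_in_order (~~ d) a b) (pair_in_order d a b).
Proof. by case: d; apply/permP => P /=; rewrite addnCA. Qed.

Lemma uniq_swap d p q a b :
  uniq (p ++ pair_in_order (~~ d) a b ++ q) = uniq (p ++ pair_in_order d a b ++ q).
Proof. by apply: perm_uniq; rewrite perm_cat2l perm_cat2r perm_pair_in_order. Qed.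

Lemma perm_swap3 d1 d2 d3 a1 b1 a2 b2 a3 b3 u v w :
  perm_eq (pair_in_order (~~ d1) a1 b1 ++ u ++ pair_in_order (~~ d2) a2 b2 ++ v ++
             pair_in_order (~~ d3) a3 b3 ++ w)
          (pair_in_order d1 a1 b1 ++ u ++ pair_in_order d2 a2 b2 ++ v ++
             pair_in_order d3 a3 b3 ++ w).
Proof.
apply: perm_cat; first exact: perm_pair_in_order.
rewrite perm_cat2l; apply: perm_cat; first exact: perm_pair_in_order.
by rewrite perm_cat2l perm_cat2r perm_pair_in_order.
Qed.

Lemma height_swap3 d1 d2 d3 a1 b1 a2 b2 a3 b3 u v w x :
  uniq (pair_in_order d1 a1 b1 ++ u ++ pair_in_order d2 a2 b2 ++ v ++
          pair_in_order d3 a3 b3 ++ w) ->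
  height (pair_in_order (~~ d1) a1 b1 ++ u ++ pair_in_order (~~ d2) a2 b2 ++ v ++
            pair_in_order (~~ d3) a3 b3 ++ w) x =
  height (pair_in_order d1 a1 b1 ++ u ++ pair_in_order d2 a2 b2 ++ v ++
            pair_in_order d3 a3 b3 ++ w) x +
  (swap_shift d1 a1 b1 x + swap_shift d2 a2 b2 x + swap_shift d3 a3 b3 x).
Proof.
move=> wU.
have := @height_swap d1 [::] (u ++ pair_in_order d2 a2 b2 ++ v ++
  pair_in_order d3 a3 b3 ++ w) a1 b1 x wU.
rewrite !cat0s => h1.
have wU1 : uniq ((pair_in_order (~~ d1) a1 b1 ++ u) ++ pair_in_order d2 a2 b2 ++ v ++
  pair_in_order d3 a3 b3 ++ w).
  by rewrite -catA -[X in uniq X]cat0s uniq_swap.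
have h2 := height_swap x wU1.
have wU2 : uniq ((pair_in_order (~~ d1) a1 b1 ++ u ++ pair_in_order (~~ d2) a2 b2 ++ v)
  ++ pair_in_order d3 a3 b3 ++ w).
  by move: wU1; rewrite -uniq_swap -!catA.
have := height_swap x wU2.
rewrite -!catA => ->; move: h2; rewrite -!catA => ->.
by rewrite h1 -!addrA.
Qed.

Lemma writhe_moveIII P tm tb mb eTM eTB eMB dT dM dB c cyc u v w :
  let T d := pair_in_order d (tm, true, eTM) (tb, true, eTB) in
  let M d := pair_in_order d (tm, false, eTM) (mb, true, eMB) in
  let B d := pair_in_order d (tb, false, eTB) (mb, false, eMB) in
  let W dT dM dB := if cyc then T dT ++ u ++ M dM ++ v ++ B dB ++ w
                           else T dT ++ u ++ B dB ++ v ++ M dM ++ w in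
  sg dT = sg c * sg eTB ->
  sg dM = sg c * sg eMB ->
  sg dB = sg c * (sg eTM * sg eTB * sg eMB) ->
  uniq (W dT dM dB) ->
  writhe P (W (~~ dT) (~~ dM) (~~ dB)) = writhe P (W dT dM dB).
Proof.
move=> T M B W hT hM hB wU.
have WP : perm_eq (W (~~ dT) (~~ dM) (~~ dB)) (W dT dM dB).
  by rewrite /W /T /M /B; case: (cyc); exact: perm_swap3.
pose shift x :=
  swap_shift dT (tm, true, eTM) (tb, true, eTB) x +
  swap_shift dM (tm, false, eTM) (mb, true, eMB) x +
  swap_shift dB (tb, false, eTB) (mb, false, eMB) x.
have heightE x :
    height (W (~~ dT) (~~ dM) (~~ dB)) x = height (W dT dM dB) x + shift x.
  move: wU; rewrite /W /T /M /B; case: (cyc) => /height_swap3 -> //.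
  by rewrite /shift; ring.
(* The sign conditions of move III make both ends of each chord move by the same height: [- sg c]
   for [tm], [sg c * sg eTM * sg eTB] for [tb], and [- sg c * sg eTM * sg eMB] for [mb]. *)
have shift_mate x : initial x -> shift (mate x) = shift x.
  case: x => [[l i] e]; rewrite /initial /= => {i}->.
  rewrite /shift /swap_shift /mate /= !xpair_eqE /= !andbF !andbT hT hM hB.
  rewrite /endpoint_sign /=.
  by case: (c) (eTM) (eTB) (eMB) => -[] -[] -[]; rewrite /sg /=; ring.
rewrite /writhe (perm_big _ WP); apply: eq_bigl => x.
case ix: (initial x) => //=.
by rewrite /hindex !heightE shift_mate //; congr (P _); ring.
Qed.

(** * Invariance of the writhe *)

Lemma writhe_reidemeister P (G H : gauss_diagram) :
  ~~ P 0 -> reidemeister G H -> writhe P G = writhe P H.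
Proof.
move=> P0; move: (gwordP G) (gwordP H); set w := gword G; set w' := gword H.
move=> + + wR; case: wR.
- by move=> x u oldG newG; rewrite writhe_moveI.
- by move=> a b e d u v oldG newG; rewrite writhe_moveII.
- move=> tm tb mb eTM eTB eMB dT dM dB c cyc u v z T M B W hT hM hB oldG newG.
  by rewrite (writhe_moveIII P hT hM hB (gauss_uniq oldG)).
Qed.

Lemma writhe_vk_equiv P (G H : gauss_diagram) :
  ~~ P 0 -> vk_equiv G H -> writhe P G = writhe P H.
Proof.
move=> P0; elim=> {G H} [G H|G|G H _ <-|G H L _ -> _ ->] //.
by case=> [/writhe_same_diagram|/writhe_reidemeister]; exact.
Qed.

(** * Effect of a 2k-move *)

Lemma height_mkseq p q (f : nat -> endpoint) n i :
  uniq (p ++ mkseq f n ++ q) -> (i < n)%N ->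
  height (p ++ mkseq f n ++ q) (f i) = total p + total (mkseq f i).
Proof.
move=> wU lt_in.
have fE : mkseq f n = mkseq f i ++ f i :: map f (iota i.+1 (n - i.+1)).
  rewrite /mkseq -[in iota 0 n](subnKC (ltnW lt_in)) iotaD map_cat add0n.
  by rewrite -[(n - i)%N]prednK ?subn_gt0 //= subnS.
move: wU; rewrite fE -catA catA cat_uniq => /and3P[_ /hasPn disj _].
have : f i \notin p ++ mkseq f i by apply: disj; rewrite cat_cons mem_head.
by rewrite height_cat => /negPf -> /=; rewrite eqxx addr0 total_cat.
Qed.

Lemma total_alternating (f : nat -> endpoint) c n :
  (forall i, (i < n)%N -> endpoint_sign (f i) = if odd i then - c else c) ->
  total (mkseq f n) = if odd n then c else 0.
Proof.
elim: n => [|n IHn] fE; first by rewrite total_nil.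
rewrite mkseqS -cats1 total_cat total_cons total_nil addr0 IHn; last first.
  by move=> i lt_in; apply: fE; rewrite ltnS ltnW.
by rewrite fE //=; case: (odd n); rewrite /= ?subrr ?add0r.
Qed.

(** Each two successive endpoints comprise one of each kind, so [k] of them have kind [t], whichever
    kind comes first. *)
Lemma sum_initial_alternating (g : nat -> nat) (s e t : bool) k :
  \sum_(x <- mkseq (fun i => (g i, s (+) odd i, e) : endpoint) (2 * k)
        | initial x == t) sg (positive x) = sg e * k%:Z.
Proof.
elim: k => [|k IHk]; first by rewrite muln0 big_nil mulr0.
rewrite mulnS addnC addn2 !mkseqS -!cats1 !big_cat IHk /= !big_cons !big_nil.
rewrite /initial /positive /= oddM /=.
by case: (s) (t) => -[] /=; lia.
Qed.

(* [m] is the index computed at any endpoint on the arc A; [hindex] takes the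
   opposite value at the mate, so chords starting on A' have index [- m]. *)
Lemma writhe_twists k (w w' : seq endpoint) :
  is_gauss w -> is_gauss w' -> adds_twists k w w' ->
  exists (m : int) (e : bool), forall P : pred int,
    writhe P w' = writhe P w + sg e * k%:Z * ((P m)%:R + (P (- m))%:R).
Proof.
move=> + + wT; case: wT => g e s r u v A A' oldG newG.
pose F i : endpoint := (g i, s (+) odd i, e).
(* [F'] lists the arc A' in the order in which it is read; its signs alternate too, starting with
   [q] if reversed and with [- q] if not. *)
pose F' i : endpoint := if r then mate (F (2 * k - i.+1)%N) else mate (F i).
pose q := endpoint_sign (F 0%N).
have FE i : endpoint_sign (F i) = if odd i then - q else q.
  by rewrite /q /F /endpoint_sign /= addbF; case: (s); case: (odd i); rewrite /= ?opprK.
have F'E i : (i < 2 * k)%N -> endpoint_sign (F' i) =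
    if odd i then - (if r then q else - q) else (if r then q else - q).
  move=> lt_i; rewrite /F'; case: (r); rewrite endpoint_sign_mate FE.
    rewrite oddB // oddM /=; by case: (odd i); rewrite ?opprK.
  by case: (odd i).
have A'E : A' = mkseq F' (2 * k).
  rewrite /A' /F' /A; case: (r); last by rewrite /mkseq -map_comp.
  rewrite -map_rev /mkseq.
  apply: (@eq_from_nth _ (F 0%N)); rewrite ?size_map ?size_rev ?size_map // size_iota.
  move=> i lt_i; rewrite (nth_map (F 0%N)) ?size_rev ?size_map ?size_iota //.
  rewrite nth_rev ?size_map ?size_iota //.
  by rewrite !(nth_map 0%N) ?size_iota ?nth_iota ?add0n //; lia.
have totF n : total (mkseq F n) = if odd n then q else 0.
  by apply: total_alternating => i _; exact: FE.
have A0 : total A = 0 by rewrite [LHS]totF oddM.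
have A'0 : total A' = 0 by rewrite A'E (total_alternating F'E) oddM.
set w1 := A ++ u ++ A' ++ v in newG *.
(* Height plus own sign along A is [q] at even places and 0 at odd ones. The height of the mate,
   less [total u], is [q] and 0 respectively if A' is reversed, and 0 and [- q] if not. The
   difference does not depend on the place. *)
exists (total u + if r then 0 else - q), e => P.
have hindexA x : x \in A -> hindex w1 x = total u + if r then 0 else - q.
  case/mapP=> i; rewrite mem_iota add0n => /= lt_i ->; rewrite -/(F i).
  have wU := gauss_uniq newG.
  have -> : hindex w1 (F i) = total u + total (mkseq F' (if r then 2 * k - i.+1 else i)%N)
      - total (mkseq F i) - endpoint_sign (F i).
    rewrite /hindex; congr (_ - _ - _); last first.
      by rewrite -[w1]cat0s (height_mkseq (p := [::])) ?total_nil ?add0r.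
    have -> : mate (F i) = F' (if r then 2 * k - i.+1 else i)%N.
      by rewrite /F'; case: (r) => //; congr (mate (F _)); lia.
    have w1E : w1 = (A ++ u) ++ mkseq F' (2 * k) ++ v by rewrite -A'E -catA.
    have lt_j : ((if r then 2 * k - i.+1 else i) < 2 * k)%N by case: (r); lia.
    rewrite w1E in wU *; rewrite (height_mkseq wU lt_j).
    by rewrite total_cat A0 add0r.
  rewrite totF (total_alternating (c := if r then q else - q)).
    rewrite FE; case: (r); last by case: (odd i); ring.
    by rewrite oddB // oddM /=; case: (odd i) => /=; ring.
  by move=> j lt_j; apply: F'E; move: lt_j; case: (r); lia.
rewrite writhe_insert //; congr (_ + _); rewrite -/w1 big_cat /=.
have sumA t (b : bool) : \sum_(x <- A | (initial x == t) && b) sg (positive x) =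
    sg e * k%:Z * b%:R.
  case: b; last by rewrite big_pred0 ?mulr0 // => x; rewrite andbF.
  rewrite mulr1 -(sum_initial_alternating g s e t k).
  by apply: eq_bigl => x; rewrite andbT.
rewrite mulrDr; congr (_ + _).
  rewrite -(sumA true) big_seq_cond [RHS]big_seq_cond; apply: eq_bigl => x.
  by case xA: (x \in A) => //=; rewrite hindexA // eqb_id.
(* Initial endpoints on A' are the mates of the terminal endpoints on A, which explains [sumA false]
   and the opposite index. *)
have A'P : perm_eq A' (map mate A) by rewrite /A'; case: (r); rewrite ?perm_rev.
rewrite (perm_big _ A'P) big_map -(sumA false).
rewrite big_seq_cond [RHS]big_seq_cond; apply: eq_bigl => x.
by case xA: (x \in A) => //=; rewrite hindex_mate hindexA // eqbF_neg.
Qed.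

(** * The odd writhe, and the congruences *)

Definition oddz : pred int := fun n => (n %% 2)%Z == 1.

Lemma odd_writheE K : odd_writhe K = writhe oddz (repr K).
Proof.
rewrite /odd_writhe /nwrithe; set G := repr K.
(* [half x] is the only [n] for which [2 * n - 1] can be the index of [x], so the finitely many
   values of [half] contain the support of the sum. *)
pose half x := ((hindex (gword G) x + 1) %/ 2)%Z.
rewrite (@fsbigE _ _ _ _ _ (undup (map half G))) ?undup_uniq //; last first.
  move=> n _; rewrite mem_undup => nG.
  rewrite gwritheE /writhe big_seq_cond big_pred0 // => x.
  apply/negP => /and3P[xG _ /= /eqP hx]; case/negP: nG; apply/mapP; exists x => //.
  by rewrite /half hx; lia.
rewrite (eq_bigl xpredT) => [|n]; last by rewrite in_setT.
under eq_bigr do rewrite gwritheE /writhe big_mkcond.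
rewrite exchange_big /writhe [RHS]big_mkcond /= big_seq [RHS]big_seq.
apply: eq_bigr => x xG.
case: (initial x) => /=; last by rewrite big1.
case: ifP => [/eqP hx|/negP hx]; last first.
  rewrite big1 // => n _; case: eqP => // hn; case: hx; rewrite /oddz hn.
  by apply/eqP; lia.
rewrite (bigD1_seq (half x)) ?undup_uniq ?mem_undup ?map_f //=.
rewrite big1 ?addr0.
  by rewrite ifT //; apply/eqP; rewrite /half; lia.
move=> n /eqP nx; case: eqP => // hn; case: nx; rewrite /half hn; lia.
Qed.

Lemma writhe_diagram_of P G K : ~~ P 0 -> diagram_of G K -> writhe P G = writhe P (repr K).
Proof.
move=> P0 GK; apply: writhe_vk_equiv => //; apply/asboolP.
by have /eqmodP := etrans GK (esym (reprK K)).
Qed.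

Theorem theorem1p1 (k : nat) (hk : (0 < k)%N) (K K' : virtual_knot)
    (hKK' : related_by_2k_moves k K K') :
  (forall n : int, n <> 0%R -> (nwrithe K n = nwrithe K' n %[mod k%:Z])%Z) /\
  (odd_writhe K = odd_writhe K' %[mod (2 * k)%N%:Z])%Z.
Proof.
have step (P : pred int) (d : nat) : ~~ P 0 ->
    (forall m, (d%:Z %| k%:Z * ((P m)%:R + (P (- m))%:R))%Z) ->
    (writhe P (repr K) = writhe P (repr K') %[mod d%:Z])%Z.
  move=> P0 dP; elim: hKK' => [{}K {}K' [G [G' [GK GK' GG']]]|//|L M N _ -> _ ->//].
  rewrite -(writhe_diagram_of P0 GK) -(writhe_diagram_of P0 GK').
  clear K K' GK GK'.
  wlog twGG' : G G' GG' / adds_twists k G G'.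
    by move=> IH; case: GG' => GG'; [|symmetry]; apply: IH => //; left.
  have [m [e ->]] := writhe_twists (gwordP G) (gwordP G') twGG'.
  apply/eqP; rewrite eqz_mod_dvd opprD addrA subrr add0r -mulrA -mulNr.
  by rewrite dvdz_mull.
split=> [n n0|].
  rewrite /nwrithe !gwritheE; apply: step => [|m]; first by rewrite /= eq_sym; apply/eqP.
  exact: dvdz_mulr.
rewrite !odd_writheE; apply: step => // m.
(* The two indicators then agree, so their sum is 0 or 2; this is what improves the modulus from [k]
   to [2 * k]. *)
have -> : oddz (- m) = oddz m by rewrite /oddz; lia.
case: (oddz m); last by rewrite addr0 mulr0 dvdz0.
by rewrite mulnC PoszM.
Qed.
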